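(* Let $d\ge 1$ and $\beta\in(0,2)$. Let $F$ and $G$ be cumulative distribution functions on $\mathbb{R}^d$ with univariate marginals $F_1,\dots,F_d$ and $G_1,\dots,G_d$, respectively. Then $$S_\beta(F,G)\ \ge\ \mathbb{E}\left(Z^{\beta/2}\right),\qquad\text{where } Z=\sum_{i=1}^d\left((F_i\Diamond G_i)^{-1}(U)\right)^2$$ and $U$ is a random variable uniformly distributed on $(0,1)$. Moreover, if $F_1=\dots=F_d$ and $G_1=\dots=G_d$, then this bound is sharp: it is attained for the upper Fréchet bounds $F=F^+$ and $G=G^+$, and in this case it reduces to $$S_\beta(F,G)\ \ge\ S_\beta(F^+,G^+)\ =\ d^{\beta/2}\,M_\beta(F_1,G_1).$$
   Context: Cumulative distribution functions (cdfs) are identified with the corresponding probability measures. For cdfs $F,G$ on $\mathbb{R}^d$ and $\beta\in(0,2)$, $$S_\beta(F,G)=\mathbb{E}\left(\|\boldsymbol X-\boldsymbol Y\|_2^\beta\right)=\int\|\boldsymbol x-\boldsymbol y\|_2^\beta\,F(d\boldsymbol x)\,G(d\boldsymbol y)\in[0,\infty],$$ where $\boldsymbol X\sim F$ and $\boldsymbol Y\sim G$ are independent and $\|\cdot\|_2$ is the Euclidean norm. For univariate cdfs $F,G$, $M_\beta(F,G)=\int|x-y|^\beta\,F(dx)\,G(dy)$, and $F\Diamond G$ denotes the cdf of $|X-Y|$, where $X\sim F$ and $Y\sim G$ are independent. For a univariate cdf $H$, $H^{-1}(u)=\inf\{x: H(x)\ge u\}$ is the quantile function. For given marginals $F_1,\dots,F_d$,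 the upper Fréchet bound is the cdf $F^+(\boldsymbol x)=\min\{F_1(x_1),\dots,F_d(x_d)\}$; similarly $G^+(\boldsymbol x)=\min\{G_1(x_1),\dots,G_d(x_d)\}$. *)

(* Defs.v *)
From HB Require Import structures.
From mathcomp Require Import all_boot all_order all_algebra.
From mathcomp Require Import all_classical all_reals all_analysis.
From mathcomp Require Import measurable_realfun.

Set Implicit Arguments.
Unset Strict Implicit.
Unset Printing Implicit Defensive.

Import Order.TTheory GRing.Theory Num.Theory.
Import numFieldNormedType.Exports.

Local Open Scope classical_set_scope.
Local Open Scope ring_scope.

(* R^d is [d.-tuple R] with the product sigma-algebra, which is the Borel one. *)

Section coordinates.
Context {R : realType} (d : nat).

Definition proj_coord (i : 'I_d) (x : d.-tuple R) : R := tnth x i.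

HB.instance Definition _ (i : 'I_d) :=
  @isMeasurableFun.Build _ _ (d.-tuple R) R (proj_coord i) (measurable_tnth i).

Definition euclid_dist (x y : d.-tuple R) : R :=
  Num.sqrt (\sum_(i < d) (tnth x i - tnth y i) ^+ 2).

End coordinates.

Section absdiff.
Context {R : realType}.

Definition absdiff (p : R * R) : R := `|p.1 - p.2|.

Let measurable_absdiff : measurable_fun [set: R * R] absdiff.
Proof.
apply: measurableT_comp; first exact: normr_measurable.
apply: measurable_funB; [exact: measurable_fst | exact: measurable_snd].
Qed.

HB.instance Definition _ :=
  @isMeasurableFun.Build _ _ (R * R)%type R absdiff measurable_absdiff.

End absdiff.

(* A cdf is represented by the corresponding probability measure; independence
   of X ~ F and Y ~ G is rendered by the product measure F \x G. *)
Section cdfs.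
Context {R : realType}.
Local Open Scope ereal_scope.

Definition energyS (d : nat) (beta : R) (F G : probability (d.-tuple R) R) :
    \bar R :=
  \int[F \x G]_p ((euclid_dist p.1 p.2) `^ beta)%:E.

Definition energyM (beta : R) (F G : probability R R) : \bar R :=
  \int[F \x G]_p (`|p.1 - p.2| `^ beta)%:E.

Definition diamond (F G : probability R R) (x : R) : \bar R :=
  cdf (absdiff : {RV (F \x G) >-> R}) x.

(* For a cdf H and u in ]0, 1[ the set below is nonempty and bounded below, so
   [inf] is a genuine infimum; otherwise it may take the default value 0. *)
Definition quantile (H : R -> \bar R) (u : R) : R :=
  inf [set x : R | u%:E <= H x].

Definition joint_cdf (d : nat) (F : probability (d.-tuple R) R)
    (x : d.-tuple R) : \bar R :=
  F [set y | forall i, (tnth y i <= tnth x i)%R].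

Definition marginal (d : nat) (F : probability (d.-tuple R) R) (i : 'I_d) :
    probability R R :=
  distribution F (proj_coord i).

Definition marginal_cdf (d : nat) (F : probability (d.-tuple R) R) (i : 'I_d) :
    R -> \bar R :=
  cdf (proj_coord i : {RV F >-> R}).

Definition upper_frechet (d : nat) (F : probability (d.-tuple R) R)
    (x : d.-tuple R) : \bar R :=
  \big[Order.min/+oo]_(i < d) marginal_cdf F i (tnth x i).

Definition comonotoneZ (d : nat) (F G : probability (d.-tuple R) R) (u : R) :
    R :=
  (\sum_(i < d) (quantile (diamond (marginal F i) (marginal G i)) u) ^+ 2)%R.

(* The uniform law on ]0, 1[ coincides with the one on [0, 1]. *)
Definition uniform01 (dO : measure_display) (Omega : measurableType dO)
    (P : probability Omega R) (U : {RV P >-> R}) : Prop :=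
  forall A : set R, measurable A ->
    distribution P U A = uniform_prob (@ltr01 R) A.

End cdfs.

(* Main.v *)
(** The function [s |-> s `^ a], [0 < a < 1], is a positive mixture of the
    truncations [s |-> min s t], so it is enough to compare the expectations of
    [min (\sum_i W_i) t] with [W_i = |X_i - Y_i|^2].  Whenever
    [\sum_i t_i <= t], pointwise
    [\sum_i min W_i t_i <= min (\sum_i W_i) t], and the expectation of the left
    side only depends on the laws of the [W_i].  If the [W_i] are replaced by
    nondecreasing functions of a single variable [u], then the [t_i] can be
    chosen so that the converse inequality holds for every [u]: take [t_i]
    between the values of the i-th function before and after the crossing of
    the level [t] by the sum.  Truncation makes every expectation finite, so no
    moment assumption is needed.

    For identical marginals the upper Frechet bound is the law of
    [(X, ..., X)], since a probability on R^d is determined by its joint cdf. *)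

Require Import Defs.
From HB Require Import structures.
From mathcomp Require Import all_boot all_order all_algebra.
From mathcomp Require Import all_classical all_reals all_analysis.
From mathcomp Require Import measurable_realfun ring lra.

Set Implicit Arguments.
Unset Strict Implicit.
Unset Printing Implicit Defensive.

Import Order.TTheory GRing.Theory Num.Theory.
Import numFieldNormedType.Exports.

Local Open Scope classical_set_scope.
Local Open Scope ring_scope.

(** * Laws on the line and their cdfs *)

(** Complements of the half-lines []-oo, x]] are the rays []x, +oo[], a pi-system that generates the
    Borel sets and covers the line countably. *)
Lemma probability_cdf_unique (R : realType) (mu nu : probability R R) :
  (forall x, mu `]-oo, x]%classic = nu `]-oo, x]%classic) ->
  forall A, measurable A -> mu A = nu A.
Proof.
move=> munu A mA.
have G1 : @RGenOInfty.G R `<=` measurable by move=> _ [x ->].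
have G2 (k : nat) : @RGenOInfty.G R `]- k%:R, +oo[%classic by exists (- k%:R).
have G3 : \bigcup_(k : nat) `]- k%:R, +oo[%classic = [set: R].
  rewrite -subTset => x _; exists (Num.bound `|x|) => //=.
  rewrite in_itv/= andbT ltrNl (le_lt_trans (ler_norm _))//.
  by rewrite normrN archi_boundP.
have G4 : setI_closed (@RGenOInfty.G R).
  move=> _ _ [x ->] [y ->]; exists (Order.max x y).
  by apply/seteqP; split => z /=; rewrite !in_itv/= !andbT gt_max => /andP.
have G5 B : @RGenOInfty.G R B -> mu B = nu B.
  by move=> [x ->]; rewrite -setCitvl !probability_setC// munu.
apply: (g_sigma_algebra_measure_unique _ G1 _ G2 G3 mu nu G4 G5).
  move=> k; apply: (le_lt_trans (probability_le1 mu (G1 _ (G2 k)))).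
  exact: ltry.
rewrite -[X in X A]RGenOInfty.measurableE; exact: mA.
Qed.

(** * Truncation along a monotone curve *)

(** By monotonicity, the largest of the finitely many points found for the separate indices serves
    all of them; the nonemptiness of [D] covers an empty index set. *)
Lemma exists_common_lbound (R : realType) (D : set R) (I : finType)
    (s : I -> R -> R) (l : I -> R) :
  {in D &, forall u v, (u <= v)%R -> forall i, (s i u <= s i v)%R} ->
  (forall i, exists2 u, D u & (l i < s i u)%R) ->
  D !=set0 -> exists2 u, D u & forall i, (l i < s i u)%R.
Proof.
move=> smono sl [u0 Du0].
suff [u Du Hu] : exists2 u, D u & forall i, i \in enum I -> (l i < s i u)%R.
  by exists u => // i; apply: Hu; rewrite mem_enum.
elim: (enum I) => [|j r [u Du IH]]; first by exists u0.
have [v Dv jv] := sl j; have [uv|/ltW vu] := leP u v.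
  exists v => // i; rewrite inE => /predU1P[->//|/IH] /lt_le_trans; apply.
  by apply: smono; rewrite ?inE.
exists u => // i; rewrite inE => /predU1P[->|/IH//].
by apply: (lt_le_trans jv); apply: smono; rewrite ?inE.
Qed.

(** Functions increasing in a common variable come close to their suprema simultaneously, so a bound
    on the sum passes to the sum of the suprema. *)
Lemma sum_sup_le (R : realType) (D : set R) (I : finType) (s : I -> R -> R)
    (t : R) :
  {in D &, forall u v, (u <= v)%R -> forall i, (s i u <= s i v)%R} ->
  (forall i, has_sup (s i @` D)) -> D !=set0 ->
  (forall u, D u -> \sum_i s i u <= t) ->
  \sum_i sup (s i @` D) <= t.
Proof.
move=> smono hs D0 st; rewrite leNgt; apply/negP => ts.
(* With [#|I|.+1] in the denominator, losing [e] once per index costs strictly less than the excess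
   over [t]. *)
pose e := (\sum_i sup (s i @` D) - t) / #|I|.+1%:R.
have e0 : 0 < e by rewrite divr_gt0// subr_gt0.
have [|u Du su] :=
  exists_common_lbound smono (l := fun i => sup (s i @` D) - e) _ D0.
  move=> i; have [_ [u Du <-] su] := sup_adherent e0 (hs i).
  by exists u.
have := st u Du; apply/negP; rewrite -ltNge.
apply: (@lt_le_trans _ _ (\sum_i (sup (s i @` D) - e))); last first.
  by apply: ler_sum => i _; exact/ltW.
rewrite sumrB sumr_const ltrBrDl -ltrBrDr -mulr_natr /e.
rewrite -mulrA gtr_pMr ?subr_gt0// mulrC ltr_pdivrMr// mul1r ltr_nat.
by rewrite cardE.
Qed.

(** The reflection of both [u] and the values [s i u] preserves monotonicity and turns infima into
    suprema. *)
Lemma sum_inf_ge (R : realType) (D : set R) (I : finType) (s : I -> R -> R)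
    (t : R) :
  {in D &, forall u v, (u <= v)%R -> forall i, (s i u <= s i v)%R} ->
  (forall i, has_inf (s i @` D)) -> D !=set0 ->
  (forall u, D u -> t <= \sum_i s i u) ->
  t <= \sum_i inf (s i @` D).
Proof.
move=> smono hs [u0 Du0] st.
pose D' := [set u | D (- u)]; pose s' i u := - s i (- u).
have s'E i : s' i @` D' = -%R @` (s i @` D).
  apply/seteqP; split=> [_ [u Du <-]|_ [_ [u Du <-] <-]].
    by exists (s i (- u)) => //; exists (- u).
  by exists (- u); rewrite /D' /s' /= opprK.
rewrite -lerN2 -sumrN.
under eq_bigr do rewrite /inf opprK -s'E.
apply: sum_sup_le.
- move=> u v; rewrite !inE => Du Dv uv i; rewrite lerN2.
  by apply: smono; rewrite ?inE// lerN2.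
- by move=> i; rewrite s'E; apply/has_inf_supN.
- by exists (- u0); rewrite /D' /= opprK.
- by move=> u Du; rewrite sumrN lerN2 st.
Qed.

(* On the part [A] of [D] where the sum is at most [t], every [s i] stays below
   its supremum [a i]; on the rest [B] it stays above its infimum [b i].  Any
   [tau] between [a] and [b] with total [t] works. *)
Lemma exists_truncation_levels (R : realType) (D : set R) (I : finType)
    (s : I -> R -> R) (t : R) :
  (forall i u, D u -> 0 <= s i u) ->
  {in D &, forall u v, (u <= v)%R -> forall i, (s i u <= s i v)%R} ->
  0 <= t ->
  exists tau : I -> R, [/\ forall i, 0 <= tau i, \sum_i tau i <= t &
    forall u, D u ->
      Num.min (\sum_i s i u) t <= \sum_i Num.min (s i u) (tau i)].
Proof.
move=> s0 smono t0.
pose A := [set u | D u /\ \sum_i s i u <= t].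
pose B := [set u | D u /\ t < \sum_i s i u].
have AB u v : A u -> B v -> forall i, s i u <= s i v.
  move=> [Du su] [Dv sv]; apply: (smono u v); rewrite ?inE//.
  rewrite leNgt; apply/negP => /ltW vu.
  have := le_lt_trans su sv; rewrite ltNge => /negP; apply.
  by apply: ler_sum => i _; apply: smono; rewrite ?inE.
have ubA i : ubound (s i @` A) t.
  move=> _ [u [Du su] <-]; apply: le_trans su.
  by rewrite (bigD1 i)//= lerDl sumr_ge0// => j _; exact: s0.
pose a i := sup (s i @` A).
have a0 i : 0 <= a i.
  (* For empty [A], [sup] takes the default value 0, which is still a valid lower level. *)
  have [AE|/set0P[u Au]] := eqVneq A set0.
    by rewrite /a AE image_set0 sup0.
  apply: (le_trans (s0 i u Au.1)); apply: ub_le_sup; last by exists u.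
  by exists t.
have Aa u i : A u -> s i u <= a i.
  by move=> Au; apply: ub_le_sup; [exists t|exists u].
have aT : \sum_i a i <= t.
  have [AE|/set0P A0] := eqVneq A set0.
    by rewrite big1// => i _; rewrite /a AE image_set0 sup0.
  apply: sum_sup_le => //.
  - by move=> u v /[!inE] -[Du _] [Dv _]; apply: smono; rewrite inE.
  - move=> i; split; last by exists t.
    by have [u Au] := A0; exists (s i u); exists u.
  - by move=> u [].
have sumA tau : (forall i, a i <= tau i) -> forall u, A u ->
    Num.min (\sum_i s i u) t <= \sum_i Num.min (s i u) (tau i).
  move=> atau u Au; rewrite ge_min; apply/orP; left.
  by apply: ler_sum => i _; rewrite le_min lexx (le_trans (Aa _ _ Au)).
have [BE|/set0P B0] := eqVneq B set0.
  exists a; split => // u Du; apply: sumA => //; split => //.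
  by rewrite leNgt; apply/negP => su; have : B u by []; rewrite BE.
pose b i := inf (s i @` B).
have lbB i : lbound (s i @` B) 0 by move=> _ [u [Du _] <-]; exact: s0.
have Bb u i : B u -> b i <= s i u.
  by move=> Bu; apply: ge_inf; [exists 0|exists u].
have B0i i : s i @` B !=set0 by have [u Bu] := B0; exists (s i u); exists u.
have ab i : a i <= b i.
  apply: lb_le_inf => // _ [v Bv <-].
  have [AE|/set0P A0] := eqVneq A set0.
    by rewrite /a AE image_set0 sup0 s0//; case: Bv.
  apply: ge_sup; first by have [u Au] := A0; exists (s i u); exists u.
  by move=> _ [u Au <-]; exact: AB.
have bT : t <= \sum_i b i.
  apply: sum_inf_ge => //.
  - by move=> u v /[!inE] -[Du _] [Dv _]; apply: smono; rewrite inE.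
  - by move=> i; split => //; exists 0.
  - by move=> u [_ /ltW].
(* As [t] lies between the sums of [a] and of [b], some convex combination has total exactly [t];
   equal sums are set apart to avoid dividing by 0. *)
have [th [th0 th1 thE]] : exists th : R, [/\ 0 <= th, th <= 1 &
    \sum_i a i + th * (\sum_i b i - \sum_i a i) = t].
  have [E|E] := eqVneq (\sum_i a i) (\sum_i b i).
    exists 0; split => //; rewrite mul0r addr0; apply/eqP.
    by rewrite eq_le aT E bT.
  have ab' : 0 < \sum_i b i - \sum_i a i.
    by rewrite subr_gt0 lt_neqAle E (le_trans aT).
  exists ((t - \sum_i a i) / (\sum_i b i - \sum_i a i)); split.
  - by rewrite divr_ge0 ?subr_ge0 ?(le_trans aT).
  - by rewrite ler_pdivrMr// mul1r lerB.
  - by rewrite divfK ?gt_eqF// addrC subrK.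
pose tau i := a i + th * (b i - a i).
have tauE : \sum_i tau i = t.
  by rewrite big_split/= -mulr_sumr sumrB thE.
have atau i : a i <= tau i by rewrite lerDl mulr_ge0// subr_ge0.
have taub i : tau i <= b i.
  by rewrite /tau -lerBrDl ler_piMl// subr_ge0.
exists tau; split => [i||u Du]; first exact: le_trans (atau i).
  by rewrite tauE.
(* On [A] no term is truncated, since [s i u <= a i <= tau i]; on [B] every term is, since
   [tau i <= b i <= s i u], and the levels add up to [t]. *)
have [su|su] := leP (\sum_i s i u) t; first by rewrite -(min_l su); exact: sumA.
rewrite -{1}tauE; apply: ler_sum => i _.
by rewrite le_min lexx andbT (le_trans (taub i))// Bb.
Qed.

(** * Powers as mixtures of truncations *)

Lemma cvgy_powRN (R : realType) (e : R) : (0 < e)%R ->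
  (x `^ (- e))%R @[x --> +oo%R] --> (0 : R)%R.
Proof.
move=> e0.
under eq_cvg do rewrite powRN.
have pos : \forall x \near +oo%R, (0 < x `^ e)%R.
  near=> x; apply: powR_gt0; near: x.
  by apply: nbhs_pinfty_gt; exact: num_real.
suff powy : (x `^ e)%R @[x --> +oo%R] --> +oo%R.
  exact: (iffRL (gtr0_cvgV0 pos)).
apply/cvgryPge => A; near=> x.
rewrite (le_trans (ler_norm A))//.
have -> : (`|A| = (`|A| `^ e^-1) `^ e)%R.
  by rewrite -powRrM mulVf ?gt_eqF// powRr1.
have x0 : (`|A| `^ e^-1 <= x)%R.
  by near: x; apply: nbhs_pinfty_ge; exact: num_real.
apply: ge0_ler_powR; rewrite ?nnegrE ?powR_ge0 ?ltW//.
Unshelve. all: by end_near. Qed.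

(* [level a] is the inverse function of [x |-> x `^ (a - 1)], which is the
   derivative of [x |-> x `^ a / a]: the area below the graph of this derivative
   on [0, s] is the integral of [min s (level a v)] over [v > 0]. *)
Definition level (R : realType) (a v : R) : R :=
  (if 0 < v then v `^ (- (1 - a)^-1) else 0)%R.

Lemma measurable_level (R : realType) (a : R) : measurable_fun setT (level a).
Proof.
by apply: measurable_fun_ifT => //; exact: measurable_fun_ltr.
Qed.

Lemma level_ge0 (R : realType) (a v : R) : (0 <= level a v)%R.
Proof. by rewrite /level; case: ifP => // _; exact: powR_ge0. Qed.

Lemma continuous_powR_gt0 (R : realType) (e x : R) : (0 < x)%R ->
  {for x, continuous (fun y : R => y `^ e)%R}.
Proof.
move=> x0; apply: differentiable_continuous; apply/derivable1_diffP.
by apply: derivable_powR; rewrite in_itv/= andbT.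
Qed.

Lemma integral_powR_tail (R : realType) (e c : R) : (0 < e)%R -> (0 < c)%R ->
  (\int[lebesgue_measure]_(v in `[c, +oo[) (v `^ (- e - 1))%:E =
   (c `^ (- e) / e)%:E)%E.
Proof.
move=> e0 c0.
rewrite (@ge0_continuous_FTC2y _ _ (fun v => - e^-1 * v `^ (- e))%R _ 0)%R.
- rewrite -EFinD; congr EFin; rewrite sub0r mulNr opprK mulrC//.
- by move=> x cx; exact: powR_ge0.
- apply/continuous_within_itvcyP; split.
    move=> x; rewrite in_itv/= andbT => cx.
    exact/continuous_powR_gt0/(lt_trans c0).
  exact/cvg_at_right_filter/continuous_powR_gt0.
- rewrite -[X in _ --> X](mulr0 (- e^-1)).
  by apply: cvgM; [exact: cvg_cst|exact: cvgy_powRN].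
- move=> x cx; apply: derivableM => //.
  by apply: derivable_powR; rewrite in_itv/= andbT (lt_trans c0).
- apply: cvg_at_right_filter; apply: cvgM; first exact: cvg_cst.
  exact: continuous_powR_gt0.
- move=> x; rewrite in_itv/= andbT => cx; have x0 := lt_trans c0 cx.
  rewrite derive1E deriveM//; last first.
    by apply: derivable_powR; rewrite in_itv/= andbT.
  have [_ dpow] := is_derive1_powR (- e) x0.
  rewrite derive_val dpow scaler0 addr0 /GRing.scale/=.
  by field; rewrite gt_eqF.
Qed.

Lemma integral_min_level (R : realType) (a s : R) : 0 < a < 1 -> 0 <= s ->
  (\int[lebesgue_measure]_v (Num.min s (level a v))%:E = (s `^ a / a)%:E)%E.
Proof.
move=> /andP[a0 a1] s0.
have a1' : 0 < 1 - a by rewrite subr_gt0.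
have f0 v : (0 <= (Num.min s (level a v))%:E)%E.
  by rewrite lee_fin le_min s0 level_ge0.
have [->|sN0] := eqVneq s 0.
  rewrite powR0 ?gt_eqF// mul0r; apply: integral0_eq => v _.
  by rewrite min_l ?level_ge0.
have {sN0} s_gt0 : 0 < s by rewrite lt_def sN0.
have mf : measurable_fun setT (fun v => (Num.min s (level a v))%:E).
  apply/measurable_EFinP; apply: measurable_minr => //.
  exact: measurable_level.
pose c := s `^ (a - 1).
have c0 : 0 < c by exact: powR_gt0.
(* This [e] makes the exponent of [level a] equal to [- e - 1], the form of the tail integral. *)
pose e := a / (1 - a).
have e0 : 0 < e by exact: divr_gt0.
have eE : - (1 - a)^-1 = - e - 1.
  by rewrite /e; field; rewrite gt_eqF.
have cs : level a c = s.
  rewrite /level c0 -powRrM (_ : (a - 1) * _ = 1) ?powRr1//.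
  by field; rewrite gt_eqF.
have ce : c `^ (- e) = s `^ a.
  rewrite -powRrM (_ : (a - 1) * _ = a)//.
  by rewrite /e; field; rewrite gt_eqF.
have level_anti : {in `]0, +oo[ &, {homo level a : x y /~ x <= y}}.
  move=> x y; rewrite !in_itv/= !andbT => x0 y0 yx; rewrite /level x0 y0.
  rewrite !powRN lef_pV2 ?posrE ?powR_gt0//.
  by apply: ge0_ler_powR; rewrite ?nnegrE ?invr_ge0 // ltW.
have -> : [set: R] = `]-oo, 0] `|` (`]0, c[ `|` `[c, +oo[).
  apply/esym; rewrite -subTset => x _ /=; rewrite !in_itv/= ?andbT.
  by case: (leP x 0) => x0; [left|right; case: (ltP x c) => xc; [left|right]].
rewrite ge0_integral_setU//=;
  [|exact: measurableU|exact: measurable_funTS|]; last first.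
  apply/disj_setPS => x /= [] + []; rewrite !in_itv/= ?andbT.
    by move=> x0 /andP[]; rewrite ltNge x0.
  by move=> x0 cx; have := lt_le_trans c0 (le_trans cx x0); rewrite ltxx.
rewrite ge0_integral_setU//=; [|exact: measurable_funTS|]; last first.
  apply/disj_setPS => x /= []; rewrite !in_itv/= andbT => /andP[_].
  by rewrite ltNge => /negbTE ->.
rewrite integral0_eq ?add0e; last first.
  by move=> x /=; rewrite in_itv/= => x0; rewrite /level ltNge x0/= min_r.
have -> : (\int[lebesgue_measure]_(x in `]0%R, c[) (Num.min s (level a x))%:E =
   (s * c)%:E)%E.
  under eq_integral => x.
    rewrite inE/= in_itv/= => /andP[x0 xc].
    rewrite min_l; last first.
      by rewrite -[leLHS]cs level_anti ?in_itv/= ?x0 ?c0 ?ltW.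
    over.
  rewrite integral_cst//= lebesgue_measure_itv/= lte_fin c0 -EFinD subr0.
  by rewrite -EFinM.
have -> : (\int[lebesgue_measure]_(x in `[c, +oo[) (Num.min s (level a x))%:E =
   (s `^ a / e)%:E)%E.
  rewrite -ce -integral_powR_tail//; apply: eq_integral => x.
  rewrite inE/= in_itv/= andbT => cx.
  have x0 := lt_le_trans c0 cx.
  rewrite min_r; first by rewrite /level x0 eE.
  by rewrite -[leRHS]cs level_anti ?in_itv/= ?x0 ?c0.
rewrite -EFinD; congr EFin.
rewrite /c -{1}(powRr1 s0) -powRD; last by rewrite (gt_eqF s_gt0) implybT.
rewrite addrCA subrr addr0 /e.
by field; rewrite !gt_eqF.
Qed.

Lemma integral_powR_layer d (T : measurableType d) (R : realType)
    (P : probability T R) (S : T -> R) (a : R) : 0 < a < 1 ->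
  measurable_fun setT S -> (forall x, 0 <= S x) ->
  (\int[P]_x (S x `^ a)%:E =
   a%:E * \int[lebesgue_measure]_v \int[P]_x (Num.min (S x) (level a v))%:E)%E.
Proof.
move=> a01 mS S0.
pose f (z : T * R) : \bar R := (Num.min (S z.1) (level a z.2))%:E.
have mf : measurable_fun setT f.
  apply/measurable_EFinP; apply: measurable_minr.
    exact: measurableT_comp.
  by apply: measurableT_comp => //; exact: measurable_level.
have f0 z : (0 <= f z)%E by rewrite lee_fin le_min S0 level_ge0.
have a0 : 0 < a by case/andP: a01.
have := @fubini_tonelli _ _ _ _ _ P lebesgue_measure f mf f0.
rewrite /f /= => <-.
rewrite -ge0_integralZl//=.
- apply: eq_integral => x _; rewrite integral_min_level// -EFinM.
  by rewrite mulrC divfK// gt_eqF.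
- exact: (@measurable_fun_fubini_tonelli_F _ _ _ _ R lebesgue_measure f mf f0).
- by move=> x _; apply: integral_ge0 => v _; exact: (f0 (x, v)).
- by rewrite lee_fin ltW.
Qed.

(** The layer formula has a nonnegative integrand in the level, so the comparison at each level
    integrates, even to infinite values. *)
Lemma le_integral_powR d1 d2 (T1 : measurableType d1) (T2 : measurableType d2)
    (R : realType) (P1 : probability T1 R) (P2 : probability T2 R)
    (S1 : T1 -> R) (S2 : T2 -> R) (a : R) : 0 < a < 1 ->
  measurable_fun setT S1 -> measurable_fun setT S2 ->
  (forall x, 0 <= S1 x) -> (forall x, 0 <= S2 x) ->
  (forall t, 0 <= t -> (\int[P1]_x (Num.min (S1 x) t)%:E <=
                        \int[P2]_x (Num.min (S2 x) t)%:E)%E) ->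
  (\int[P1]_x (S1 x `^ a)%:E <= \int[P2]_x (S2 x `^ a)%:E)%E.
Proof.
move=> a01 mS1 mS2 S10 S20 H; rewrite !integral_powR_layer//.
apply: lee_wpmul2l; first by rewrite lee_fin; case/andP: a01 => /ltW.
have mF d (T : measurableType d) (P : probability T R) (S : T -> R) :
    measurable_fun setT S -> (forall x, 0 <= S x) ->
    measurable_fun setT (fun v => \int[P]_x (Num.min (S x) (level a v))%:E)%E.
  move=> mS S0.
  apply: (measurable_fun_fubini_tonelli_G
    (fun z : T * R => (Num.min (S z.1) (level a z.2))%:E)).
    apply/measurable_EFinP; apply: measurable_minr.
      exact: measurableT_comp.
    by apply: measurableT_comp => //; exact: measurable_level.
  by move=> z; rewrite lee_fin le_min S0 level_ge0.
apply: ge0_le_integral => //.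
- move=> v _; apply: integral_ge0 => x _.
  by rewrite lee_fin le_min S10 level_ge0.
- exact: (mF _ _ P1 S1 mS1 S10).
- exact: (mF _ _ P2 S2 mS2 S20).
- by move=> v _; apply: H; exact: level_ge0.
Qed.

(** * The quantile transform *)

Lemma cdf_fine d (T : measurableType d) (R : realType) (Q : probability T R)
    (X : {RV Q >-> R}) x : cdf X x = (fine (cdf X x))%:E.
Proof. by rewrite fineK// fin_num_measure. Qed.

(** The Galois connection between cdf and quantile: the limits at both infinities make the infimum
    genuine, and right-continuity makes it attained. *)
Lemma quantile_le d (T : measurableType d) (R : realType) (Q : probability T R)
    (X : {RV Q >-> R}) (u x : R) :
  0 < u < 1 -> (quantile (cdf X) u <= x) = (u%:E <= cdf X x)%E.
Proof.
move=> /andP[u0 u1].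
set S := [set x : R | (u%:E <= cdf X x)%E].
pose H := fine \o cdf X.
have HE y : cdf X y = (H y)%:E by exact: cdf_fine.
have SE y : S y <-> u <= H y by rewrite /S /= HE lee_fin.
have S0 : S !=set0.
  have H1 : H y @[y --> +oo] --> (1 : R) by apply: fine_cvg; exact: cvg_cdfy1.
  have [M [_ HM]] := cvgr_gt _ H1 _ u1.
  by exists (M + 1); apply/SE/ltW/HM; rewrite ltrDl.
have lbS : has_lbound S.
  have H0 : H y @[y --> -oo] --> (0 : R) by apply: fine_cvg; exact: cvg_cdfNy0.
  have [M [_ HM]] := cvgr_lt _ H0 _ u0.
  exists M => y /SE uy; rewrite leNgt; apply/negP => /HM.
  by rewrite ltNge uy.
have Hnd : {homo H : y z / y <= z}.
  move=> y z yz; rewrite -lee_fin -!HE; exact: cdf_nondecreasing.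
apply/idP/idP => [qx|ux]; last by apply: ge_inf.
apply/SE; apply: (le_trans _ (Hnd _ _ qx)).
(* If the cdf were below [u] at the infimum, it would stay below [u] just to the right, where points
   of [S] must accumulate. *)
rewrite leNgt; apply/negP => Hq.
have Hrc : H y @[y --> (inf S)^'+] --> H (inf S).
  by apply: fine_cvg; rewrite -HE; exact: cdf_right_continuous.
have [e /= e0 He] := cvgr_lt _ Hrc _ Hq.
have [y Sy ye] := inf_adherent e0 (conj S0 lbS).
have qy : inf S <= y by exact: ge_inf.
move: qy; rewrite le_eqVlt => /predU1P[qy|qy].
  by move/SE : Sy; rewrite -qy leNgt Hq.
have : H y < u.
  apply: He => //=; rewrite distrC gtr0_norm ?subr_gt0//.
  by rewrite ltrBlDl.
by move/SE : Sy; rewrite leNgt => /negP.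
Qed.

(* Here [quantile] takes the default value of [inf]: the set is unbounded below
   if [u <= 0], and empty if [1 < u]. *)
Lemma quantile_out d (T : measurableType d) (R : realType) (Q : probability T R)
    (X : {RV Q >-> R}) (u : R) :
  u <= 0 \/ 1 < u -> quantile (cdf X) u = 0.
Proof.
move=> u01; rewrite /quantile inf_out// => -[].
case: u01 => u01 [x ux] [M MS]; last first.
  have := le_trans ux (cdf_le1 X x); rewrite lee_fin leNgt u01//.
have : M <= M - 1.
  by apply: MS => /=; rewrite (le_trans _ (cdf_ge0 X _))// lee_fin.
by lra.
Qed.

(** On []0, 1[] the Galois connection turns preimages of rays into rays; elsewhere the function is
    the constant 0, up to the single point 1. *)
Lemma measurable_quantile d (T : measurableType d) (R : realType)
    (Q : probability T R) (X : {RV Q >-> R}) :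
  measurable_fun setT (quantile (cdf X)).
Proof.
have -> : [set: R] = `]-oo, 0] `|` (`]0, 1[ `|` ([set 1] `|` `]1, +oo[)).
  apply/esym; rewrite -subTset => x _ /=; rewrite !in_itv/= andbT.
  by case: (leP x 0) => x0; [left|right; case: (ltgtP x 1) => x1;
    [left|right; right|right; left]].
apply/measurable_funU => //; [by do ?apply: measurableU|split].
  apply: (@eq_measurable_fun _ _ _ _ _ (fun=> 0 : R)) => // x.
  rewrite inE/= in_itv/= => x0.
  by rewrite quantile_out//; left.
apply/measurable_funU => //; [by do ?apply: measurableU|split]; last first.
  apply/measurable_funU => //; split; first exact: measurable_fun_set1.
  apply: (@eq_measurable_fun _ _ _ _ _ (fun=> 0 : R)) => // x.
  rewrite inE/= in_itv/= andbT => x0.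
  by rewrite quantile_out//; right.
apply: (measurability (@RGenOInfty.G R)); first exact: RGenOInfty.measurableE.
move=> _ [_ [x ->] <-].
rewrite [X in measurable X](_ : _ = `]0, 1[ `&` `]fine (cdf X x), +oo[).
  exact: measurableI.
apply/seteqP; split => u /= []; rewrite !in_itv/= !andbT => u01 + ; split => //.
  by move: b; rewrite !ltNge quantile_le// cdf_fine lee_fin.
by move: b; rewrite !ltNge quantile_le// cdf_fine lee_fin.
Qed.

Lemma uniform_prob01 (R : realType) (A : set R) : measurable A ->
  A `<=` `[0, 1]%classic -> uniform_prob (@ltr01 R) A = lebesgue_measure A.
Proof.
move=> mA A01; rewrite /uniform_prob.
rewrite (eq_integral (cst 1%E)); last first.
  move=> x /set_mem /A01 /=; rewrite in_itv/= /uniform_pdf => ->.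
  by rewrite subr0 invr1.
by rewrite integral_cst// mul1e.
Qed.

Lemma probability_setI1 d (T : measurableType d) (R : realType)
    (P : probability T R) (A B : set T) :
  measurable A -> measurable B -> P B = 1%E -> P (A `&` B) = P A.
Proof.
move=> mA mB PB.
have PAB : P (A `\` B) = 0%E.
  apply: (@subset_measure0 _ _ _ _ _ (~` B)) => //.
  - exact: measurableD.
  - exact: measurableC.
  - by rewrite [LHS]probability_setC// PB subee.
by rewrite [RHS](measureDI P mA mB) [X in (X + _)%E]PAB add0e.
Qed.

(** * The inverse transform of a uniform variable *)

Section uniform_quantile.
Context (R : realType) (dO : measure_display) (Omega : measurableType dO)
  (P : probability Omega R) (U : {RV P >-> R}) (U_unif : uniform01 U)
  (d : measure_display) (T : measurableType d) (Q : probability T R)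
  (X : {RV Q >-> R}).

Lemma uniform01_in_oo : P (U @^-1` `]0, 1[) = 1%E.
Proof.
have := U_unif (measurable_itv `]0, 1[).
rewrite uniform_prob01//; last by apply: subset_itvW.
by rewrite lebesgue_measure_itv/= lte_fin ltr01 sube0 => <-.
Qed.

Lemma ae_uniform01_in_oo : {ae P, forall w, 0 < U w < 1}.
Proof.
have mI : measurable (U @^-1` `]0, 1[) by exact: measurable_funPTI.
exists (~` (U @^-1` `]0, 1[)); split.
- exact: measurableC.
- by rewrite probability_setC// uniform01_in_oo subee.
- by move=> w /= h; apply: contra_not h; rewrite in_itv.
Qed.

(** Almost surely [U] lies in []0, 1[], and there the event reads [U w <= cdf X x]. *)
Lemma uniform01_quantile_le (x : R) :
  P [set w | quantile (cdf X) (U w) <= x] = cdf X x.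
Proof.
set I := U @^-1` `]0, 1[; set V := [set w | _].
have mI : measurable I by exact: measurable_funPTI.
have mV : measurable V.
  have := measurableT_comp (measurable_quantile X)
    (@measurable_funPT _ _ _ _ U).
  move=> /(_ measurableT `]-oo, x]%classic (measurable_itv _)).
  by rewrite setTI set_itvNyc.
rewrite -(probability_setI1 mV mI uniform01_in_oo).
pose h := fine (cdf X x).
have hE : cdf X x = h%:E by exact: cdf_fine.
have h0 : 0 <= h by rewrite -lee_fin -hE cdf_ge0.
have h1 : h <= 1 by rewrite -lee_fin -hE cdf_le1.
have -> : V `&` I = U @^-1` (`]0, 1[ `&` `]-oo, h]).
  apply/seteqP; split => w /= [] A B; split; move: A B;
    rewrite /I /V /= !in_itv/= => A B //.
    by rewrite -lee_fin -hE -quantile_le.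
  by rewrite quantile_le// hE lee_fin.
have mJ : measurable (`]0, 1[ `&` `]-oo, h] : set R) by exact: measurableI.
have := U_unif mJ.
rewrite uniform_prob01//; last first.
  by move=> u /= []; rewrite !in_itv/= => /andP[/ltW -> /ltW ->].
move=> e; rewrite [LHS]e hE.
(* The intersection is []0, 1[] for [h = 1] but []0, h]] for [h < 1]; its length is [h] in both
   cases. *)
move: h1; rewrite le_eqVlt => /predU1P[h1|h1].
  rewrite setIidl.
    by rewrite lebesgue_measure_itv/= lte_fin ltr01 sube0 h1.
  by move=> u /=; rewrite !in_itv/= h1 => /andP[_ /ltW].
have -> : `]0, 1[ `&` `]-oo, h] = `]0, h]%classic.
  apply/seteqP; split => u /=; rewrite !in_itv/=; first by move=> [/andP[-> _]].
  by move=> /andP[-> uh]; rewrite uh (le_lt_trans uh).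
rewrite lebesgue_measure_itv/= lte_fin sube0; case: ltP => // h0'.
by congr EFin; apply/eqP; rewrite eq_le h0 h0'.
Qed.

Lemma integral_uniform_quantile (f : R -> \bar R) :
  measurable_fun setT f -> (forall x, 0 <= f x)%E ->
  (\int[P]_w f (quantile (cdf X) (U w)) = \int[Q]_x f (X x))%E.
Proof.
move=> mf f0.
have mV : measurable_fun setT (quantile (cdf X) \o U).
  exact: measurableT_comp (measurable_quantile X) _.
pose V : {RV P >-> R} := HB.pack (quantile (cdf X) \o U)
  (isMeasurableFun.Build _ _ _ _ _ mV).
rewrite -(@ge0_integral_distribution _ _ _ _ _ Q X f mf f0).
rewrite -(@ge0_integral_distribution _ _ _ _ _ P V f mf f0).
apply: eq_measure_integral => A mA _; apply: probability_cdf_unique => // x.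
rewrite -[RHS]/(cdf X x) -uniform01_quantile_le; congr (P _).
Qed.

End uniform_quantile.

(** Tonelli reduces this to one change of variables per factor. It serves to pull integrals against
    products of marginals, or of diagonal laws, back to the original product. *)
Lemma integral_prod_distribution d1 d2 d1' d2' (T1 : measurableType d1)
    (T2 : measurableType d2) (T1' : measurableType d1')
    (T2' : measurableType d2') (R : realType) (mu : probability T1 R)
    (nu : probability T2 R) (phi : {mfun T1 >-> T1'}) (psi : {mfun T2 >-> T2'})
    (f : T1' * T2' -> \bar R) :
  measurable_fun setT f -> (forall z, 0 <= f z)%E ->
  (\int[distribution mu phi \x distribution nu psi]_z f z =
   \int[mu \x nu]_z f (phi z.1, psi z.2))%E.
Proof.
move=> mf f0.
have mg : measurable_fun setT (fun z : T1 * T2 => f (phi z.1, psi z.2)).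
  apply: measurableT_comp => //; apply: measurable_fun_pair => /=.
    exact: (measurableT_comp (@measurable_funPT _ _ _ _ phi) measurable_fst).
  exact: (measurableT_comp (@measurable_funPT _ _ _ _ psi) measurable_snd).
rewrite !fubini_tonelli1//.
rewrite ge0_integral_distribution; last 2 first.
- exact: (@measurable_fun_fubini_tonelli_F _ _ _ _ R
    (distribution nu psi) f mf f0).
- by move=> x; apply: integral_ge0.
apply: eq_integral => x _; rewrite /fubini_F /=.
rewrite ge0_integral_distribution//.
exact: measurableT_comp.
Qed.

(** * Joint distribution functions *)

Section joint_cdf.
Context (R : realType) (d : nat).

Let box (x : d.-tuple R) :=
  [set y : d.-tuple R | forall i, tnth y i <= tnth x i].

Let boxes := [set B | exists x, B = box x].

Let measurable_box x : measurable (box x).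
Proof.
have -> : box x = \bigcap_(i in [set: 'I_d])
    ((@tnth d R)^~ i @^-1` `]-oo, tnth x i]).
  apply/seteqP; split => [y xy i _|y xy i] /=; first by rewrite in_itv/= xy.
  by have := xy i I; rewrite /= in_itv.
apply: fin_bigcap_measurable; first exact: finite_finset.
move=> i _; rewrite -[X in measurable X]setTI.
exact: (measurable_tnth i).
Qed.

Let boxI : setI_closed boxes.
Proof.
move=> _ _ [x ->] [y ->]; exists [tuple Num.min (tnth x i) (tnth y i) | i < d].
apply/seteqP; split => z /=.
  by move=> [xz yz] i; rewrite tnth_mktuple le_min xz yz.
by move=> xyz; split => i; have := xyz i;
  rewrite tnth_mktuple le_min => /andP[].
Qed.

Let exists_tuple_bound (y : d.-tuple R) :
  exists n : nat, forall i, tnth y i <= n%:R.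
Proof.
exists (\max_i Num.bound `|tnth y i|) => i.
rewrite (le_trans (ler_norm _))// (le_trans (ltW (archi_boundP _)))// ler_nat.
exact: (leq_bigmax i).
Qed.

(** It suffices that coordinates are measurable for the sigma-algebra of the boxes: a half-space is
    a countable union of boxes whose other sides grow to infinity. *)
Let measurable_boxes (A : set (d.-tuple R)) : measurable A -> <<s boxes >> A.
Proof.
move=> mA.
have mid : measurable_fun setT (id : g_sigma_algebraType boxes -> d.-tuple R).
  apply/measurable_fun_tnthP => i.
  apply: (measurability (@RGenOInfty.G R)); first exact: RGenOInfty.measurableE.
  move=> _ [_ [r ->] <-]; rewrite setTI -setCitvl preimage_setC.
  apply: measurableC.
  rewrite [X in measurable X](_ : _ =
    \bigcup_n box [tuple if j == i then r else n%:R | j < d]).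
    apply: bigcup_measurable => n _; apply: sub_sigma_algebra.
    by eexists; reflexivity.
  apply/seteqP; split => y /=; rewrite in_itv/=.
    move=> yr; have [n yn] := exists_tuple_bound y.
    by exists n => // j /=; rewrite tnth_mktuple; case: eqP => [->|].
  by move=> [n _ /(_ i)]; rewrite tnth_mktuple eqxx.
by have := mid measurableT A mA; rewrite setTI preimage_id.
Qed.

(** Boxes form a generating pi-system, and the boxes with all corners equal to [n] cover the
    space. *)
Lemma joint_cdf_unique (F1 F2 : probability (d.-tuple R) R) :
  joint_cdf F1 =1 joint_cdf F2 -> forall A, measurable A -> F1 A = F2 A.
Proof.
move=> F12 A /measurable_boxes.
have boxm : boxes `<=` measurable by move=> _ [x ->].
have boxn (n : nat) : boxes (box [tuple n%:R | i < d]) by eexists; reflexivity.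
apply: (g_sigma_algebra_measure_unique _ boxm _ boxn) => //.
- rewrite -subTset => y _; have [n yn] := exists_tuple_bound y.
  by exists n => // i; rewrite tnth_mktuple.
- by move=> _ [x ->]; exact: F12.
- move=> n; apply: (le_lt_trans (probability_le1 F1 (boxm _ (boxn n)))).
  exact: ltry.
Qed.

Definition diag (x : R) : d.-tuple R := [tuple x | i < d].

Lemma measurable_diag : measurable_fun setT diag.
Proof.
apply/measurable_fun_tnthP => i.
apply: eq_measurable_fun (@measurable_id _ _ _) => x _ /=.
by rewrite tnth_mktuple.
Qed.

HB.instance Definition _ := isMeasurableFun.Build _ _ _ _ diag measurable_diag.

(** The diagonal meets a box in the half-line ending at the smallest coordinate of its corner, and
    equal marginal cdfs take their minimum there. *)
Lemma joint_cdf_diag (F : probability (d.-tuple R) R) (mu : probability R R) :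
  (0 < d)%N -> (forall i x, marginal_cdf F i x = mu `]-oo, x]%classic) ->
  joint_cdf (distribution mu diag) =1 upper_frechet F.
Proof.
move=> d0 Fmu x.
have [i _ xi] := @arg_minP _ _ _ (Ordinal d0) xpredT (tnth x) isT.
have -> : upper_frechet F x = mu `]-oo, tnth x i]%classic.
  apply/eqP; rewrite eq_le; apply/andP; split.
    by rewrite -(Fmu i); exact: bigmin_le.
  apply: le_bigmin => [|j _]; first exact: leey.
  rewrite Fmu; apply: le_measure; rewrite ?inE//.
  by apply: subset_itvl; rewrite bnd_simp xi.
congr (mu _); apply/seteqP; split => y /=.
  by move=> /(_ i); rewrite tnth_mktuple in_itv.
by rewrite in_itv/= => yx j; rewrite tnth_mktuple (le_trans yx)// xi.
Qed.

End joint_cdf.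

Lemma eq_product_measure d1 d2 (T1 : measurableType d1) (T2 : measurableType d2)
    (R : realType) (mu mu' : probability T1 R) (nu nu' : probability T2 R) :
  (forall A, measurable A -> mu A = mu' A) ->
  (forall A, measurable A -> nu A = nu' A) ->
  forall A, measurable A -> (mu \x nu)%E A = (mu' \x nu')%E A.
Proof.
move=> mumu' nunu' A mA; apply: product_measure_unique => // B C mB mC.
apply: (etrans (product_measure1E _ _ mB mC)).
by congr (_ * _)%E; apply/esym; [exact: mumu'|exact: nunu'].
Qed.

(** * Energies *)

Section energy.
Context (R : realType) (d : nat).
Implicit Types (beta : R) (F G : probability (d.-tuple R) R).

Definition sqdist (z : d.-tuple R * d.-tuple R) : R :=
  \sum_(i < d) (tnth z.1 i - tnth z.2 i) ^+ 2.

Lemma sqdist_ge0 z : 0 <= sqdist z.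
Proof. by apply: sumr_ge0 => i _; exact: sqr_ge0. Qed.

Lemma measurable_tnth_sub (i : 'I_d) : measurable_fun setT
  (fun z : d.-tuple R * d.-tuple R => tnth z.1 i - tnth z.2 i).
Proof.
apply: measurable_funB.
  exact: (measurableT_comp (measurable_tnth i) measurable_fst).
exact: (measurableT_comp (measurable_tnth i) measurable_snd).
Qed.

Lemma measurable_sqdist : measurable_fun setT sqdist.
Proof.
apply: measurable_sum => i; apply: measurable_funX; exact: measurable_tnth_sub.
Qed.

(** Passing to squared distances gives the exponent [beta / 2], which is below 1 for [beta < 2], as
    the mixture of truncations requires. *)
Lemma energyS_powR beta F G :
  energyS beta F G = (\int[F \x G]_z (sqdist z `^ (beta / 2))%:E)%E.
Proof.
apply: eq_integral => z _; congr EFin.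
rewrite /euclid_dist -/(sqdist z) -powR12_sqrt ?sqdist_ge0//.
by rewrite -powRrM mulrC.
Qed.

Lemma eq_energyS beta (F F' G G' : probability (d.-tuple R) R) :
  (forall A, measurable A -> F A = F' A) ->
  (forall A, measurable A -> G A = G' A) ->
  energyS beta F G = energyS beta F' G'.
Proof.
move=> FF' GG'; apply: eq_measure_integral => A mA _.
exact: eq_product_measure.
Qed.

(** Between two diagonal points all [d] squared coordinate differences coincide. *)
Lemma energyS_diag beta (mu nu : probability R R) :
  energyS beta (distribution mu (diag d)) (distribution nu (diag d)) =
  (\int[mu \x nu]_z ((d%:R * `|z.1 - z.2| ^+ 2) `^ (beta / 2))%:E)%E.
Proof.
rewrite energyS_powR integral_prod_distribution.
- apply: eq_integral => z _; congr (EFin (_ `^ _)).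
  rewrite /sqdist /=; under eq_bigr do rewrite !tnth_mktuple.
  by rewrite sumr_const card_ord real_normK ?num_real// mulr_natl.
- apply/measurable_EFinP; apply: (measurableT_comp (measurable_powR _)).
  exact: measurable_sqdist.
- by move=> z; rewrite lee_fin powR_ge0.
Qed.

Lemma powR_natM_sqr beta (x : R) :
  (d%:R * `|x| ^+ 2) `^ (beta / 2) = d%:R `^ (beta / 2) * `|x| `^ beta.
Proof.
rewrite powRM ?sqr_ge0// -powR_mulrn// -powRrM.
by congr (_ * _ `^ _); rewrite mulrCA divff ?mulr1// pnatr_eq0.
Qed.

Lemma energyM_scale beta (mu nu : probability R R) :
  (\int[mu \x nu]_z ((d%:R * `|z.1 - z.2| ^+ 2) `^ (beta / 2))%:E)%E =
  ((d%:R `^ (beta / 2))%:E * energyM beta mu nu)%E.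
Proof.
rewrite /energyM -ge0_integralZl//.
- by apply: eq_integral => z _; rewrite powR_natM_sqr EFinM.
- apply/measurable_EFinP; apply: (measurableT_comp (measurable_powR _)).
  apply: measurableT_comp => //; apply: measurable_funB.
    exact: measurable_fst.
  exact: measurable_snd.
Qed.

End energy.

(** * The law of the absolute difference and its quantiles *)

Section diamond.
Context (R : realType).
Implicit Types mu nu : probability R R.

Lemma eq_diamond mu mu' nu nu' :
  (forall A, measurable A -> mu A = mu' A) ->
  (forall A, measurable A -> nu A = nu' A) ->
  diamond mu nu = diamond mu' nu'.
Proof.
move=> mumu' nunu'; apply/funext => x; apply: eq_product_measure => //.
exact: measurable_funPTI.
Qed.

Lemma measurable_quantile_diamond mu nu :
  measurable_fun setT (quantile (diamond mu nu)).
Proof. exact: (measurable_quantile (absdiff : {RV (mu \x nu)%E >-> R})). Qed.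

Lemma diamond_lt0 mu nu (x : R) : x < 0 -> diamond mu nu x = 0%E.
Proof.
move=> x0; rewrite /diamond /cdf /distribution /pushforward.
have -> : absdiff @^-1` `]-oo, x]%classic = set0; last exact: measure0.
apply/seteqP; split => z //=; rewrite in_itv/= /absdiff => zx.
by have := le_lt_trans zx x0; rewrite ltNge normr_ge0.
Qed.

Lemma quantile_diamond_le mu nu (u x : R) : 0 < u < 1 ->
  (quantile (diamond mu nu) u <= x) = (u%:E <= diamond mu nu x)%E.
Proof. exact: (quantile_le (absdiff : {RV (mu \x nu)%E >-> R})). Qed.

(** The cdf of an absolute value vanishes on negative numbers. Nonnegativity lets squaring preserve
    the monotonicity of the quantiles. *)
Lemma quantile_diamond_ge0 mu nu (u : R) : 0 < u < 1 ->
  0 <= quantile (diamond mu nu) u.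
Proof.
move=> u01; rewrite leNgt; apply/negP => q0.
have := lexx (quantile (diamond mu nu) u).
rewrite quantile_diamond_le// diamond_lt0// lee_fin leNgt.
by case/andP: u01 => ->.
Qed.

Lemma quantile_diamond_homo mu nu (u v : R) : 0 < u < 1 -> 0 < v < 1 ->
  u <= v -> quantile (diamond mu nu) u <= quantile (diamond mu nu) v.
Proof.
move=> u01 v01 uv; rewrite quantile_diamond_le//.
by rewrite (@le_trans _ _ v%:E) ?lee_fin// -quantile_diamond_le.
Qed.

Lemma integral_quantile_diamond (dO : measure_display)
    (Omega : measurableType dO) (P : probability Omega R) (U : {RV P >-> R})
    mu nu (f : R -> \bar R) : uniform01 U ->
  measurable_fun setT f -> (forall x, 0 <= f x)%E ->
  (\int[P]_w f (quantile (diamond mu nu) (U w)) =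
   \int[mu \x nu]_z f (absdiff z))%E.
Proof.
move=> U_unif mf f0.
exact: (integral_uniform_quantile U_unif (absdiff : {RV (mu \x nu)%E >-> R})).
Qed.

End diamond.

Local Open Scope ereal_scope.

(** * The comonotone lower bound *)

Section lower_bound.
Context (R : realType) (d : nat) (F G : probability (d.-tuple R) R)
  (dO : measure_display) (Omega : measurableType dO)
  (P : probability Omega R) (U : {RV P >-> R}) (U_unif : uniform01 U).

Let q (i : 'I_d) := quantile (diamond (marginal F i) (marginal G i)).

Lemma comonotoneZ_ge0 u : (0 <= comonotoneZ F G u)%R.
Proof. by apply: sumr_ge0 => i _; exact: sqr_ge0. Qed.

Lemma measurable_comonotoneZ : measurable_fun setT (comonotoneZ F G).
Proof.
apply: measurable_sum => i; apply: measurable_funX.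
exact: measurable_quantile_diamond.
Qed.

Let measurable_min_sqr (t : R) :
  measurable_fun setT (fun x : R => (Num.min (x ^+ 2) t)%:E).
Proof.
by apply/measurable_EFinP; apply: measurable_minr => //; exact: measurable_funX.
Qed.

(** Only the law of the i-th absolute difference enters, and its quantile function at [U] has that
    law, whatever the dependence between coordinates. *)
Lemma integral_min_quantile_sqr (i : 'I_d) (t : R) : (0 <= t)%R ->
  \int[P]_w (Num.min (q i (U w) ^+ 2) t)%:E =
  \int[F \x G]_z (Num.min ((tnth z.1 i - tnth z.2 i) ^+ 2) t)%:E.
Proof.
move=> t0.
have f0 (x : R) : 0 <= (Num.min (x ^+ 2) t)%:E.
  by rewrite lee_fin le_min sqr_ge0 t0.
rewrite (integral_quantile_diamond _ _ U_unif (measurable_min_sqr t) f0).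
rewrite integral_prod_distribution//.
- apply: eq_integral => z _; congr (EFin (Num.min _ _)).
  by rewrite /absdiff /= real_normK ?num_real.
- apply: (measurableT_comp (measurable_min_sqr t)).
  exact: (@measurable_funPT _ _ _ _ absdiff).
Qed.

Lemma integral_min_comonotoneZ_le (t : R) : (0 <= t)%R ->
  \int[P]_w (Num.min (comonotoneZ F G (U w)) t)%:E <=
  \int[F \x G]_z (Num.min (sqdist z) t)%:E.
Proof.
move=> t0.
have s0 i u : `]0%R, 1%R[%classic u -> (0 <= q i u ^+ 2)%R.
  by move=> _; exact: sqr_ge0.
have smono : {in `]0%R, 1%R[%classic &, forall u v, (u <= v)%R ->
    forall i, (q i u ^+ 2 <= q i v ^+ 2)%R}.
  move=> u v /[!inE]/= /[!in_itv]/= u01 v01 uv i.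
  by rewrite ler_sqr ?nnegrE ?quantile_diamond_ge0// quantile_diamond_homo.
(* The levels are adapted to the curve of squared quantiles over []0, 1[], then used for both
   expectations. *)
have [tau [tau0 taut Htau]] := exists_truncation_levels s0 smono t0.
have mq i : measurable_fun setT
    (fun w => (Num.min (q i (U w) ^+ 2) (tau i))%:E).
  apply: (measurableT_comp (measurable_min_sqr (tau i))).
  apply: (measurableT_comp (measurable_quantile_diamond _ _)).
  exact: (@measurable_funPT _ _ _ _ U).
have mz i : measurable_fun setT (fun z : d.-tuple R * d.-tuple R =>
    (Num.min ((tnth z.1 i - tnth z.2 i) ^+ 2) (tau i))%:E).
  apply: (measurableT_comp (measurable_min_sqr (tau i))).
  exact: measurable_tnth_sub.
have min0 i (x : R) : 0 <= (Num.min (x ^+ 2) (tau i))%:E.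
  by rewrite lee_fin le_min sqr_ge0 tau0.
apply: (@le_trans _ _
    (\int[P]_w \sum_(i < d) (Num.min (q i (U w) ^+ 2) (tau i))%:E)).
  (* The inequality for the levels is known on []0, 1[] only, hence almost surely along [U]. *)
  apply: ae_ge0_le_integral => //.
  - by move=> w _; rewrite lee_fin le_min comonotoneZ_ge0.
  - apply/measurable_EFinP; apply: measurable_minr => //.
    apply: (measurableT_comp measurable_comonotoneZ).
    exact: (@measurable_funPT _ _ _ _ U).
  - by move=> w _; exact: sume_ge0.
  - exact: emeasurable_sum.
  - apply: filterS (ae_uniform01_in_oo U_unif) => w Uw _.
    by rewrite sumEFin lee_fin; apply: Htau; rewrite /= in_itv.
rewrite ge0_integral_sum//.
under eq_bigr do rewrite integral_min_quantile_sqr//.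
rewrite -ge0_integral_sum//.
(* For arbitrary coordinates the reverse inequality is pointwise: the truncated terms add up to at
   most the full sum and at most the total of [tau]. *)
apply: ge0_le_integral => //.
- by move=> z _; exact: sume_ge0.
- exact: emeasurable_sum.
- apply/measurable_EFinP; apply: measurable_minr => //.
  exact: measurable_sqdist.
- move=> z _; rewrite sumEFin lee_fin le_min; apply/andP; split.
    by apply: ler_sum => i _; rewrite ge_min lexx.
  by apply: le_trans taut; apply: ler_sum => i _; rewrite ge_min lexx orbT.
Qed.

Lemma comonotone_le_energyS (beta : R) : (0 < beta)%R -> (beta < 2)%R ->
  'E_P[fun w => (comonotoneZ F G (U w) `^ (beta / 2))%R] <= energyS beta F G.
Proof.
move=> beta0 beta2; rewrite unlock energyS_powR.
apply: le_integral_powR => //.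
- by rewrite divr_gt0// ltr_pdivrMr// mul1r.
- apply: (measurableT_comp measurable_comonotoneZ).
  exact: (@measurable_funPT _ _ _ _ U).
- exact: measurable_sqdist.
- by move=> w; exact: comonotoneZ_ge0.
- by move=> z; exact: sqdist_ge0.
- exact: integral_min_comonotoneZ_le.
Qed.

(** All quantile functions coincide, so the sum is [d] times one squared quantile, which at [U] has
    the law of the squared difference. *)
Lemma comonotone_equal_marginals (beta : R) (mu nu : probability R R) :
  (forall i A, measurable A -> marginal F i A = mu A) ->
  (forall i A, measurable A -> marginal G i A = nu A) ->
  'E_P[fun w => (comonotoneZ F G (U w) `^ (beta / 2))%R] =
  \int[mu \x nu]_z ((d%:R * `|z.1 - z.2| ^+ 2) `^ (beta / 2))%:E.
Proof.
move=> Fmu Gnu; rewrite unlock.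
pose f (x : R) := ((d%:R * x ^+ 2) `^ (beta / 2))%:E.
have mf : measurable_fun setT f.
  apply/measurable_EFinP; apply: (measurableT_comp (measurable_powR _)).
  by apply: measurable_funM => //; exact: measurable_funX.
have f0 x : 0 <= f x by rewrite lee_fin powR_ge0.
rewrite -[RHS](integral_quantile_diamond mu nu U_unif mf f0).
apply: eq_integral => w _; congr (EFin (_ `^ _)%R).
rewrite /comonotoneZ.
under eq_bigr do rewrite (eq_diamond (Fmu _) (Gnu _)).
by rewrite sumr_const card_ord mulr_natl.
Qed.

End lower_bound.

(** * The bound and its sharpness for identical marginals *)

Theorem theorem6 (R : realType) (d : nat) (d_gt0 : (0 < d)%N)
    (beta : R) (beta_gt0 : (0 < beta)%R) (beta_lt2 : (beta < 2)%R)
    (F G : probability (d.-tuple R) R)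
    (dO : measure_display) (Omega : measurableType dO)
    (P : probability Omega R) (U : {RV P >-> R}) (U_unif : uniform01 U) :
  let EZ := 'E_P[fun w => (comonotoneZ F G (U w) `^ (beta / 2))%R] in
  let i1 := Ordinal d_gt0 in
  EZ <= energyS beta F G /\
  ((forall i j : 'I_d, marginal_cdf F i =1 marginal_cdf F j) ->
   (forall i j : 'I_d, marginal_cdf G i =1 marginal_cdf G j) ->
   [/\ exists Fp : probability (d.-tuple R) R, joint_cdf Fp =1 upper_frechet F,
       exists Gp : probability (d.-tuple R) R, joint_cdf Gp =1 upper_frechet G &
       forall Fp Gp : probability (d.-tuple R) R,
         joint_cdf Fp =1 upper_frechet F -> joint_cdf Gp =1 upper_frechet G ->
         [/\ energyS beta Fp Gp = EZ,
             energyS beta Fp Gp <= energyS beta F G &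
             energyS beta Fp Gp =
               (d%:R `^ (beta / 2))%:E *
               energyM beta (marginal F i1) (marginal G i1)]]).
Proof.
have h1 := comonotone_le_energyS F G U_unif beta_gt0 beta_lt2.
move=> EZ i1; split=> // Feq Geq.
set mu := marginal F i1; set nu := marginal G i1.
have Fmu i A : measurable A -> marginal F i A = mu A.
  by apply: probability_cdf_unique => x; exact: Feq.
have Gnu i A : measurable A -> marginal G i A = nu A.
  by apply: probability_cdf_unique => x; exact: Geq.
have FmuE : joint_cdf (distribution mu (diag d)) =1 upper_frechet F.
  by apply: joint_cdf_diag => // i x; exact: Feq.
have GnuE : joint_cdf (distribution nu (diag d)) =1 upper_frechet G.
  by apply: joint_cdf_diag => // i x; exact: Geq.
split; [by exists (distribution mu (diag d))|
        by exists (distribution nu (diag d))|].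
move=> Fp Gp FpE GpE.
have SE : energyS beta Fp Gp =
    \int[mu \x nu]_z ((d%:R * `|z.1 - z.2| ^+ 2) `^ (beta / 2))%:E.
  (* A joint cdf determines its law, so [Fp] and [Gp] may be replaced by the diagonal laws. *)
  rewrite -energyS_diag; apply: eq_energyS; apply: joint_cdf_unique => x.
    by rewrite FpE FmuE.
  by rewrite GpE GnuE.
have EZE : EZ = energyS beta Fp Gp.
  by rewrite SE; exact: comonotone_equal_marginals.
split; first by rewrite EZE.
  by rewrite -EZE.
by rewrite SE energyM_scale.
Qed.
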